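(* Let $\ell(\boldsymbol{u})$ be a (real-valued) stochastic process indexed by $\boldsymbol{u}\in D\subset\mathbb{R}^p$. Fix $\boldsymbol{\theta}\in D$. Let $S:=|\mathrm{spt}(\boldsymbol{\theta})|\le p/2$ and $q\in(0,1)$. Suppose the following two conditions are satisfied. 1) There is a constant $C_\ell>0$ such that $\mathsf{E}\ell(\boldsymbol{u})-\mathsf{E}\ell(\boldsymbol{\theta})\ge C_\ell\|\boldsymbol{u}-\boldsymbol{\theta}\|_2^2$ for all $\boldsymbol{u}\in D$. 2) There is $M_q>0$ such that $$\Pr\Big\{\sup_{\boldsymbol{u}\in D\setminus\{\boldsymbol{\theta}\}}\frac{|[[\ell(\boldsymbol{u})-\ell(\boldsymbol{\theta})]]|}{\|\boldsymbol{u}-\boldsymbol{\theta}\|_1}\ge M_q\Big\}\le q.$$ Given $K>1$, let $\lambda=KM_q$ and $$\widehat{\boldsymbol{\theta}}=\arg\min_{\boldsymbol{u}\in D}\{\ell(\boldsymbol{u})+\lambda\|\boldsymbol{u}\|_1\}.$$ Then with probability at least $1-q$, $$\|\widehat{\boldsymbol{\theta}}-\boldsymbol{\theta}\|_2\le\sqrt{2+\frac{(K+1)^2}{(K-1)^2}}\;\frac{(K+1)M_q\sqrt S}{C_\ell}.$$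
   Context: $\mathrm{spt}(\boldsymbol{\theta})=\{h:\theta_h\ne0\}$. For a random variable $\xi$, $[[\xi]]=\xi-\mathsf{E}\xi$; for each fixed $\boldsymbol{u}$, $[[\ell(\boldsymbol{u})-\ell(\boldsymbol{\theta})]]=\ell(\boldsymbol{u})-\ell(\boldsymbol{\theta})-\mathsf{E}[\ell(\boldsymbol{u})-\ell(\boldsymbol{\theta})]$. $x=\arg\min f$ means $f(x)=\min f$; the minimizer may not be unique, and $\widehat{\boldsymbol{\theta}}$ is any minimizer. In condition 2) and in the proof-free reading of the statement, $\mathsf{E}\ell(\cdot)$ is the nonrandom function $\boldsymbol{u}\mapsto\mathsf{E}\ell(\boldsymbol{u})$. *)

(* Defs.v *)
From HB Require Import structures.
From mathcomp Require Import all_boot all_order all_algebra.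
From mathcomp Require Import all_classical all_reals all_analysis.

Set Implicit Arguments.
Unset Strict Implicit.
Unset Printing Implicit Defensive.

Import Order.TTheory GRing.Theory Num.Theory.
Import numFieldNormedType.Exports.

Local Open Scope classical_set_scope.
Local Open Scope ring_scope.

Section vectors.
Context {R : realType} {p : nat}.

(* The library's norm on ['rV[R]_p] is the max norm, hence these two. *)
Definition l1norm (x : 'rV[R]_p) : R := \sum_i `|x 0 i|.
Definition l2norm (x : 'rV[R]_p) : R := Num.sqrt (\sum_i x 0 i ^+ 2).

Definition spt (x : 'rV[R]_p) : {set 'I_p} := [set h | x 0 h != 0]%SET.

Definition is_argmin (D : set 'rV[R]_p) (f : 'rV[R]_p -> R) (x : 'rV[R]_p) :=
  D x /\ forall u, D u -> f x <= f u.

End vectors.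

Section probability.
Context {d : measure_display} {T : measurableType d} {R : realType}.
Variable P : probability T R.

(* [[xi]] = xi - E xi; [fine] is harmless for integrable xi. *)
Definition centered (X : T -> R) (w : T) : R := X w - fine ('E_P[X])%E.

(* [P E] is only meaningful for measurable E, whereas events about an
   uncountable supremum or an arbitrary choice of minimizers need not be
   measurable.  [pr_le] bounds the outer probability from above and [pr_ge]
   the inner probability from below; on measurable events both are the usual
   inequalities, see [pr_leE] and [pr_geE]. *)
Definition pr_le (E : set T) (q : R) :=
  exists B : set T, [/\ measurable B, E `<=` B & (P B <= q%:E)%E].
Definition pr_ge (E : set T) (r : R) :=
  exists A : set T, [/\ measurable A, A `<=` E & (r%:E <= P A)%E].

Lemma pr_leE (E : set T) (q : R) :
  measurable E -> pr_le E q <-> (P E <= q%:E)%E.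
Proof.
move=> mE; split=> [[B [mB EB PB]]|PE]; last by exists E; split.
by apply: (le_trans _ PB); apply: le_measure; rewrite ?inE.
Qed.

Lemma pr_geE (E : set T) (r : R) :
  measurable E -> pr_ge E r <-> (r%:E <= P E)%E.
Proof.
move=> mE; split=> [[A [mA AE PA]]|PE]; last by exists E; split.
by apply: (le_trans PA); apply: le_measure; rewrite ?inE.
Qed.

End probability.

(* Main.v *)
(* On the event that the supremum in condition 2) is below M, comparing the
   penalized criterion at its minimizer and at theta gives, for
   v = thetahat - theta and J = spt theta,
     C |v|_2^2 <= M (sum_i K (|theta_i| - |thetahat_i|) + |v_i|).
   A summand with i outside J equals (1 - K) |v_i| <= 0, and one with i in J is
   at most (K + 1) |v_i|, so by Cauchy-Schwarz
     C |v|_2^2 <= M (K + 1) |v_J|_1 <= M (K + 1) sqrt S |v|_2.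
   This is the claimed bound even with the factor sqrt (2 + _) replaced by 1. *)
Require Import Defs.
From HB Require Import structures.
From mathcomp Require Import all_boot all_order all_algebra.
From mathcomp Require Import all_classical all_reals all_analysis.
From mathcomp Require Import ring lra.

Set Implicit Arguments.
Unset Strict Implicit.
Unset Printing Implicit Defensive.

Import Order.TTheory GRing.Theory Num.Theory.
Import numFieldNormedType.Exports.

Local Open Scope classical_set_scope.
Local Open Scope ring_scope.

(** Both sides become double sums over [A], the right one with terms [(a i ^+ 2 + a j ^+ 2) / 2],
    and [a i * a j] is at most that since [(a i - a j) ^+ 2] is nonnegative. *)
Lemma sqr_sum_le_card (R : realFieldType) (I : finType) (A : {set I})
    (a : I -> R) :
  (\sum_(i in A) a i) ^+ 2 <= #|A|%:R * \sum_(i in A) a i ^+ 2.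
Proof.
have -> : #|A|%:R * \sum_(i in A) a i ^+ 2 =
    \sum_(i in A) \sum_(j in A) (a i ^+ 2 + a j ^+ 2) / 2.
  transitivity (\sum_(i in A)
      (#|A|%:R * a i ^+ 2 + \sum_(j in A) a j ^+ 2) / 2).
    rewrite -mulr_suml big_split/= -mulr_sumr sumr_const !mulr_natl.
    by rewrite mulrDl -splitr.
  apply: eq_bigr => i _.
  by rewrite -mulr_suml big_split/= sumr_const mulr_natl.
rewrite expr2 mulr_suml; apply: ler_sum => i _.
rewrite mulr_sumr; apply: ler_sum => j _.
have := sqr_ge0 (a i - a j); lra.
Qed.

Section norms.
Context {R : realType} {p : nat}.
Implicit Types x y : 'rV[R]_p.

Lemma l1norm_ge0 x : 0 <= l1norm x.
Proof. by apply: sumr_ge0. Qed.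

Lemma l1norm_gt0 x : x != 0 -> 0 < l1norm x.
Proof.
move=> x0; rewrite lt_neqAle l1norm_ge0 andbT eq_sym.
apply: contraNneq x0 => /psumr_eq0P => x0.
by apply/eqP/rowP => i; rewrite mxE; apply/normr0_eq0/x0.
Qed.

Lemma l2norm0 : l2norm (0 : 'rV[R]_p) = 0.
Proof. by rewrite /l2norm big1 ?sqrtr0// => i _; rewrite mxE expr0n. Qed.

(** Cauchy-Schwarz on [J], after which the sum of squares is enlarged to all coordinates. *)
Lemma l1norm_restrict_le (J : {set 'I_p}) x :
  \sum_(i in J) `|x 0 i| <= Num.sqrt #|J|%:R * l2norm x.
Proof.
rewrite /l2norm -sqrtrM ?ler0n//.
rewrite -[leLHS]ger0_norm ?sumr_ge0// -sqrtr_sqr ler_wsqrtr//.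
apply: (le_trans (sqr_sum_le_card J _)); rewrite ler_wpM2l//.
rewrite [leRHS](bigID (mem J))/= -[leLHS]addr0 lerD//.
  by apply: ler_sum => i _; rewrite real_normK// num_real.
by apply: sumr_ge0 => i _; exact: sqr_ge0.
Qed.

Lemma l1norm_cone_le (K : R) x y : 1 <= K ->
  K * (l1norm y - l1norm x) + l1norm (x - y) <=
  (K + 1) * \sum_(i in spt y) `|(x - y) 0 i|.
Proof.
move=> K1; rewrite /l1norm -sumrB mulr_sumr -big_split/= mulr_sumr.
rewrite [leRHS]big_mkcond/=; apply: ler_sum => i _.
rewrite inE !mxE; case: eqVneq => [->|_] /=.
  (* Off the support the left summand is [(1 - K) * |x_i|]; this is where [1 <= K] enters. *)
  by rewrite normr0 subr0; have := normr_ge0 (x 0 i); nra.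
have : `|y 0 i| - `|x 0 i| <= `|x 0 i - y 0 i|.
  by rewrite distrC lerB_dist.
by nra.
Qed.

End norms.

Theorem proposition5p2 (R : realType) (d : measure_display)
  (T : measurableType d) (P : probability T R)
  (p : nat) (D : set 'rV[R]_p) (ell : 'rV[R]_p -> T -> R)
  (ell_int : forall u, D u -> P.-integrable setT (EFin \o ell u))
  (theta : 'rV[R]_p) (Dtheta : D theta)
  (S : nat) (S_def : S = #|spt theta|) (S_le : S%:R <= p%:R / 2 :> R)
  (q : R) (q_gt0 : 0 < q) (q_lt1 : q < 1)
  (C : R) (C_gt0 : 0 < C)
  (cond1 : forall u, D u ->
     ((C * l2norm (u - theta) ^+ 2)%:E <= 'E_P[ell u] - 'E_P[ell theta])%E)
  (M : R) (M_gt0 : 0 < M)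
  (cond2 : pr_le P
     [set w | (M%:E <= ereal_sup
        [set (`|centered P (ell u \- ell theta) w| / l1norm (u - theta))%:E
           | u in D `\ theta])%E] q)
  (K : R) (K_gt1 : 1 < K)
  (lambda : R) (lambda_def : lambda = K * M)
  (thetahat : T -> 'rV[R]_p)
  (thetahat_argmin : forall w,
     is_argmin D (fun u => ell u w + lambda * l1norm u) (thetahat w)) :
  pr_ge P
    [set w | l2norm (thetahat w - theta) <=
       Num.sqrt (2 + (K + 1) ^+ 2 / (K - 1) ^+ 2)
       * ((K + 1) * M * Num.sqrt S%:R / C)]
    (1 - q).
Proof.
have [B [mB sB PB]] := cond2.
(* [B] is a measurable cover of the bad event, so the supremum is below [M] at every point of its
   complement. *)
exists (~` B); split; first exact: measurableC.
  move=> w /= Bw; have {Bw} /negP : ~ (M%:E <= ereal_sup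
      [set (`|centered P (ell u \- ell theta) w| / l1norm (u - theta))%:E
         | u in D `\ theta])%E by move=> /sB.
  rewrite -ltNge => supM.
  have [Dhat /(_ _ Dtheta) hat_le] := thetahat_argmin w.
  set u := thetahat w in Dhat hat_le *.
  suff vle : l2norm (u - theta) <= (K + 1) * M * Num.sqrt S%:R / C.
    apply: (le_trans vle); rewrite ler_peMl//.
      by rewrite divr_ge0 ?mulr_ge0 ?sqrtr_ge0//; lra.
    rewrite -[leLHS]sqrtr1 ler_wsqrtr// -addrA lerDl.
    by rewrite addr_ge0// divr_ge0// sqr_ge0.
  (* Set apart because the supremum excludes [theta] and the last step divides by this norm. *)
  have [->|v0] := eqVneq (l2norm (u - theta)) 0.
    by rewrite divr_ge0 ?mulr_ge0 ?sqrtr_ge0//; lra.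
  have Eu : P.-integrable setT (EFin \o ell u) by exact: ell_int.
  have Et : P.-integrable setT (EFin \o ell theta) by exact: ell_int.
  (* With [w] fixed, [u] is a nonrandom point of [D], so the expectation is that of [ell] at this
     frozen point. *)
  have gap : C * l2norm (u - theta) ^+ 2 <=
      fine 'E_P[ell u \- ell theta].
    have := cond1 _ Dhat.
    rewrite unlock -integralB//= => gap.
    rewrite -lee_fin fineK//.
    have := integrable_fin_num measurableT (integrableB measurableT Eu Et).
    exact.
  have noise : `|centered P (ell u \- ell theta) w| <= M * l1norm (u - theta).
    have ut : u != theta.
      by apply: contra_neq v0 => ->; rewrite subrr l2norm0.
    have ut0 : 0 < l1norm (u - theta) by rewrite l1norm_gt0 ?subr_eq0.
    rewrite -ler_pdivrMr// -lee_fin; apply/ltW/(le_lt_trans _ supM).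
    by apply: ereal_sup_ubound; exists u => //; split=> //; exact/eqP.
  have cone := l1norm_cone_le u theta (ltW K_gt1).
  have cs := l1norm_restrict_le (spt theta) (u - theta).
  rewrite -S_def in cs.
  have basic : C * l2norm (u - theta) ^+ 2 <=
      (K + 1) * M * Num.sqrt S%:R * l2norm (u - theta).
    have : C * l2norm (u - theta) ^+ 2 <=
        M * (K * (l1norm theta - l1norm u) + l1norm (u - theta)).
      (* Only the lower deviation matters: the mean increment exceeds the observed one by at most
         [M * l1norm (u - theta)], and minimality bounds the observed one. *)
      move: noise; rewrite ler_norml /centered /= => /andP[noise _].
      move: hat_le; rewrite lambda_def; lra.
    move=> /le_trans; apply.
    rewrite (_ : (K + 1) * M * _ * _ =
      M * ((K + 1) * (Num.sqrt S%:R * l2norm (u - theta)))); last by ring.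
    rewrite ler_wpM2l ?(ltW M_gt0)//; apply: (le_trans cone).
    by rewrite ler_wpM2l//; lra.
  rewrite ler_pdivlMr// [_ * C]mulrC -(ler_pM2r (x := l2norm (u - theta))).
    by rewrite -[leLHS]mulrA -expr2.
  by rewrite lt_neqAle eq_sym v0 sqrtr_ge0.
by rewrite probability_setC// EFinB leeB.
Qed.
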